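(* Let $\eta\in\mathbb{R}$, $\sigma>0$, $k>0$ with $k>\eta$, let $d_0^Q,d_0^C,d_1^Q,d_1^C\in\mathbb{R}$, and let $$\gamma_1=\frac12-\frac{\eta}{\sigma^2}+\sqrt{\left(\frac12-\frac{\eta}{\sigma^2}\right)^2+\frac{2k}{\sigma^2}}>1,\qquad \gamma_0=\frac12-\frac{\eta}{\sigma^2}-\sqrt{\left(\frac12-\frac{\eta}{\sigma^2}\right)^2+\frac{2k}{\sigma^2}}<0,$$ $$v_0=\frac{d_1^Q-d_0^Q}{k-\eta},\qquad v_1=\frac{d_1^C-d_0^C}{k}.$$ For switching costs $D>0$, $K>0$, let $0<\underline{Q}(D,K)<\overline{Q}(D,K)$ denote the lower and upper switching thresholds, i.e. there are constants $Y_0,X_1\in\mathbb{R}$ (depending on $D,K$) such that the option values $V_0(Q)=Y_0Q^{\gamma_1}$ and $V_1(Q)=X_1Q^{\gamma_0}+v_0Q+v_1$ (for $Q>0$) satisfy, with $\overline{Q}=\overline{Q}(D,K)$ and $\underline{Q}=\underline{Q}(D,K)$, $$V_0(\overline{Q})=V_1(\overline{Q})-D,\quad V_1(\underline{Q})=V_0(\underline{Q})-K,\quad V_0'(\overline{Q})=V_1'(\overline{Q}),\quad V_0'(\underline{Q})=V_1'(\underline{Q}).$$ Assume such thresholds exist for all sufficiently small $D,K>0$. Then, as the switching costs $D$ and $K$ tend to $0$, both thresholds $\overline{Q}(D,K)$ and $\underline{Q}(D,K)$ converge to the single threshold $$Q^*=\frac{(\gamma_1-\gamma_0)\gamma_0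\gamma_1v_1}{\bigl((1-\gamma_0)\gamma_1(\gamma_1-1)-(1-\gamma_1)\gamma_0(\gamma_0-1)\bigr)v_0}=\frac{\gamma_0\gamma_1v_1}{(1-\gamma_0)(\gamma_1-1)v_0}.$$
   Context: The model is a market entry-exit real option problem for a transit service. Demand density $Q_t$ follows a geometric Brownian motion $dQ_t/Q_t=\eta\,dt+\sigma\,dw(t)$, and $k$ is the discount rate. Stage $0$ is fare-based service and stage $1$ is fare-free service. For a fixed service design, social welfare at stage $i\in\{0,1\}$ is affine in the demand density: $W_i(Q)=d_i^Q Q+d_i^C$ with real constants $d_i^Q,d_i^C$. The instantaneous welfare improvement is $\Omega(Q)=W_1(Q)-W_0(Q)=(d_1^Q-d_0^Q)Q+(d_1^C-d_0^C)$. The option values $V_0$ (operating fare-based service) and $V_1$ (operating fare-free service) satisfy $$\tfrac12\sigma^2Q^2V_0''+\eta QV_0'-kV_0=0,\qquad \tfrac12\sigma^2Q^2V_1''+\eta QV_1'-kV_1+\Omega(Q)=0 .$$ The numbers $\gamma_0<0$ and $\gamma_1>1$ are the roots of $\tfrac12\sigma^2\gamma(\gamma-1)+\eta\gamma-k=0$. The boundary conditions remove the $Q^{\gamma_0}$ term from $V_0$ and the $Q^{\gamma_1}$ term from $V_1$, giving $V_0(Q)=Y_0Q^{\gamma_1}$ and $V_1(Q)=X_1Q^{\gamma_0}+v_0Q+v_1$. $D$ and $K$ are the switching costs appearing in the value-matching conditions at the upper threshold $\overline{Q}$ and the lower threshold $\underline{Q}$, respectively; the two derivative conditions are the smooth-pasting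 conditions. *)

(* Defs.v *)
From Stdlib Require Import Reals.
From Coquelicot Require Import Coquelicot.
Open Scope R_scope.

Definition gamma1 (eta sigma k : R) : R :=
  1 / 2 - eta / sigma ^ 2 +
  sqrt ((1 / 2 - eta / sigma ^ 2) ^ 2 + 2 * k / sigma ^ 2).

Definition gamma0 (eta sigma k : R) : R :=
  1 / 2 - eta / sigma ^ 2 -
  sqrt ((1 / 2 - eta / sigma ^ 2) ^ 2 + 2 * k / sigma ^ 2).

(* The option values are meaningful for [Q > 0] only, where [Rpower Q g] is
   the real power [exp (g * ln Q)]. *)
Definition V0 (g1 Y0 Q : R) : R := Y0 * Rpower Q g1.

Definition V1 (g0 v0 v1 X1 Q : R) : R := X1 * Rpower Q g0 + v0 * Q + v1.

(* [Qlow] is the lower threshold and [Qup] the upper one. Both option values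
   are differentiable on [Q > 0], so [Derive] is the genuine derivative at the
   thresholds. *)
Definition switching_thresholds (g0 g1 v0 v1 D K Qlow Qup : R) : Prop :=
  0 < Qlow < Qup /\
  exists Y0 X1 : R,
    V0 g1 Y0 Qup = V1 g0 v0 v1 X1 Qup - D /\
    V1 g0 v0 v1 X1 Qlow = V0 g1 Y0 Qlow - K /\
    Derive (V0 g1 Y0) Qup = Derive (V1 g0 v0 v1 X1) Qup /\
    Derive (V0 g1 Y0) Qlow = Derive (V1 g0 v0 v1 X1) Qlow.

(* Joint limit of [f D K] as [(D, K)] tends to [(0, 0)] with [D, K > 0]. *)
Definition lim_costs_to_0 (f : R -> R -> R) (l : R) : Prop :=
  filterlim (fun p : R * R => f (fst p) (snd p))
    (filter_prod (at_right 0) (at_right 0)) (locally l).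

(* Main.v *)
(** Write [q = Qlow], [Q = Qup = q e^T] and [F = V0 - V1], so that [F q = K],
    [F Q = - D] and [F' q = F' Q = 0]. The two smooth-pasting conditions
    determine [Y0] and [X1] from [q] and [T]: [b Y0 q^b = v0 q w] and
    [- a X1 q^a = v0 q (1 - w)], where [a = g0], [b = g1] and the weight
    [w = w(T)] in [(0, 1)] is defined by
    [w e^((b-1)T) + (1 - w) e^((a-1)T) = 1]. Value matching then becomes
    [v0 q (1 - w/b - (1 - w)/a) = - v1 - K] and [v0 q Phi(T) = K + D], with
    [Phi > 0] by strict convexity of the exponential. Hence [v0 > 0] and
    [v1 < 0], [q] stays away from [0] and [Q] stays bounded, so [Phi(T) -> 0]
    and [T -> 0] by compactness; finally [w(T) -> (1 - a)/(b - a)], which gives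
    the limit of [q]. *)

Require Import Defs.
From Stdlib Require Import Reals Lra.
From Coquelicot Require Import Coquelicot.
Open Scope R_scope.

(** * Location of the characteristic roots *)

Lemma lt_sqrt (x y : R) : x ^ 2 < y -> x < sqrt y.
Proof.
  intros H.
  assert (Hy : 0 <= y) by nra.
  pose proof (sqrt_pos y) as Hs.
  pose proof (sqrt_sqrt y Hy) as Hss.
  nra.
Qed.

(** The squares of [1/2 + eta/sigma^2] and [1/2 - eta/sigma^2] differ by [2 eta/sigma^2], so after
    squaring the claim is [eta < k]. *)
Lemma gamma1_gt1 (eta sigma k : R) :
  0 < sigma -> eta < k -> 1 < gamma1 eta sigma k.
Proof.
  intros hs hk; unfold gamma1.
  assert (Hs : 0 < / sigma ^ 2) by (apply Rinv_0_lt_compat; nra).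
  assert (H : 1 / 2 + eta / sigma ^ 2
            < sqrt ((1 / 2 - eta / sigma ^ 2) ^ 2 + 2 * k / sigma ^ 2)).
  { apply lt_sqrt; unfold Rdiv; nra. }
  lra.
Qed.

Lemma gamma0_lt0 (eta sigma k : R) :
  0 < sigma -> 0 < k -> gamma0 eta sigma k < 0.
Proof.
  intros hs hk; unfold gamma0.
  assert (Hs : 0 < / sigma ^ 2) by (apply Rinv_0_lt_compat; nra).
  assert (H : 1 / 2 - eta / sigma ^ 2
            < sqrt ((1 / 2 - eta / sigma ^ 2) ^ 2 + 2 * k / sigma ^ 2)).
  { apply lt_sqrt; unfold Rdiv; nra. }
  lra.
Qed.

(** * Convexity of the exponential *)

Lemma exp_tangent (c y : R) : exp c * (1 + (y - c)) <= exp y.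
Proof.
  replace (exp y) with (exp c * exp (y - c)) by (rewrite <- exp_plus; f_equal; ring).
  apply Rmult_le_compat_l; [left; apply exp_pos | apply exp_ineq1_le].
Qed.

Lemma exp_tangent_strict (c y : R) : y <> c -> exp c * (1 + (y - c)) < exp y.
Proof.
  intros H.
  replace (exp y) with (exp c * exp (y - c)) by (rewrite <- exp_plus; f_equal; ring).
  apply Rmult_lt_compat_l; [apply exp_pos | apply exp_ineq1; lra].
Qed.

(** The tangent at the intermediate point lies strictly below the curve at both ends; averaging the
    two inequalities with weights [1 - th] and [th] cancels the linear terms. *)
Lemma exp_chord_strict (m th T : R) :
  m <> 0 -> T <> 0 -> 0 < th < 1 ->
  exp (m * (th * T)) < (1 - th) + th * exp (m * T).
Proof.
  intros Hm HT Hth.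
  assert (HmT : m * T <> 0) by (apply Rmult_integral_contrapositive; auto).
  assert (H0 : exp (m * (th * T)) * (1 + (0 - m * (th * T))) < exp 0).
  { apply exp_tangent_strict; nra. }
  assert (H1 : exp (m * (th * T)) * (1 + (m * T - m * (th * T))) < exp (m * T)).
  { apply exp_tangent_strict; nra. }
  rewrite exp_0 in H0.
  set (e := exp (m * (th * T))) in *.
  nra.
Qed.

(** * The smooth-pasting weight and its limit at zero *)

(* The solution [w] of [w e^((b-1)T) + (1 - w) e^((a-1)T) = 1]; it is only
   meaningful for [T <> 0]. *)
Definition weight (a b T : R) : R :=
  (1 - exp ((a - 1) * T)) / (exp ((b - 1) * T) - exp ((a - 1) * T)).

Lemma exp_lt1_gt1 (a b T : R) :
  a < 0 -> 1 < b -> 0 < T ->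
  exp ((a - 1) * T) < 1 /\ 1 < exp ((b - 1) * T).
Proof.
  intros Ha Hb HT; pose proof exp_0 as H0.
  assert (exp ((a - 1) * T) < exp 0) by (apply exp_increasing; nra).
  assert (exp 0 < exp ((b - 1) * T)) by (apply exp_increasing; nra).
  lra.
Qed.

Lemma weight_bounds (a b T : R) :
  a < 0 -> 1 < b -> 0 < T -> 0 < weight a b T < 1.
Proof.
  intros Ha Hb HT.
  destruct (exp_lt1_gt1 a b T Ha Hb HT) as [H1 H2].
  unfold weight; split.
  - apply Rdiv_lt_0_compat; lra.
  - apply -> Rdiv_lt_1; lra.
Qed.

Lemma weight_barycenter (a b T : R) :
  a < 0 -> 1 < b -> 0 < T ->
  weight a b T * exp ((b - 1) * T) + (1 - weight a b T) * exp ((a - 1) * T) = 1.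
Proof.
  intros Ha Hb HT.
  destruct (exp_lt1_gt1 a b T Ha Hb HT) as [H1 H2].
  unfold weight; field; lra.
Qed.

Lemma weight_unique (a b T u w s : R) :
  a < 0 -> 1 < b -> 0 < T ->
  u + w = s -> u * exp ((b - 1) * T) + w * exp ((a - 1) * T) = s ->
  u = s * weight a b T /\ w = s * (1 - weight a b T).
Proof.
  intros Ha Hb HT E1 E2.
  destruct (exp_lt1_gt1 a b T Ha Hb HT) as [H1 H2].
  assert (Hu : u = s * weight a b T).
  { unfold weight.
    apply Rmult_eq_reg_r with (exp ((b - 1) * T) - exp ((a - 1) * T)); [| lra].
    field_simplify; [| lra].
    rewrite <- E1 in E2 at 1. rewrite <- E1. nra. }
  split; [exact Hu | rewrite Rmult_minus_distr_l; lra].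
Qed.

(** With [x = (b - a) T] and [r = (1 - a)/(b - a)], the weight is [(e^(r x) - 1)/(e^x - 1)], and
    tangent inequalities at both ends compare it with [r]. The explicit bound gives the limit
    despite the [0/0] at [T = 0]. *)
Lemma weight_near_0 (a b T : R) :
  a < 0 -> 1 < b -> 0 < T ->
  Rabs (weight a b T - (1 - a) / (b - a)) <= exp ((b - a) * T) - 1.
Proof.
  intros Ha Hb HT.
  assert (HE : 1 < exp ((b - a) * T)) by (rewrite <- exp_0; apply exp_increasing; nra).
  (* This is the barycenter identity multiplied by [e^((1-a)T)]. *)
  assert (Hw : weight a b T * (exp ((b - a) * T) - 1) = exp ((1 - a) * T) - 1).
  { pose proof (weight_barycenter a b T Ha Hb HT) as H.
    replace (exp ((b - a) * T)) with (exp ((b - 1) * T) * exp ((1 - a) * T))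
      by (rewrite <- exp_plus; f_equal; ring).
    assert (Hi : exp ((a - 1) * T) * exp ((1 - a) * T) = 1)
      by (rewrite <- exp_plus, <- exp_0; f_equal; ring).
    set (be := weight a b T) in *; set (E1 := exp ((b - 1) * T)) in *.
    set (e0 := exp ((a - 1) * T)) in *; set (e1 := exp ((1 - a) * T)) in *.
    transitivity ((be * E1 + (1 - be) * e0) * e1 - be - (1 - be) * (e0 * e1)); [ring |].
    rewrite H, Hi; ring. }
  pose proof (exp_ineq1_le ((1 - a) * T)) as L1.
  pose proof (exp_ineq1_le ((b - a) * T)) as L2.
  pose proof (exp_tangent ((b - a) * T) 0) as U2.
  pose proof (exp_tangent ((1 - a) * T) 0) as U1.
  assert (Hle : exp ((1 - a) * T) <= exp ((b - a) * T)) by (left; apply exp_increasing; nra).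
  rewrite exp_0 in U1, U2.
  assert (HT1 : 0 < (b - a) * T) by nra.
  set (E := exp ((b - a) * T)) in *.
  set (e := exp ((1 - a) * T)) in *.
  set (r := (1 - a) / (b - a)).
  assert (Hr : r * ((b - a) * T) = (1 - a) * T) by (unfold r; field; lra).
  assert (Hr0 : 0 < r < 1).
  { unfold r; split; [apply Rdiv_lt_0_compat; lra |].
    apply -> Rdiv_lt_1; lra. }
  set (x := (b - a) * T) in *.
  set (be := weight a b T) in *.
  apply Rabs_le; split; apply Rmult_le_reg_r with (E - 1); try lra;
    rewrite Rmult_minus_distr_r, Hw.
  - (* [e - 1 >= r x] and [E - 1 <= x E] *)
    assert (r * (E - 1) <= r * (x * E)) by (apply Rmult_le_compat_l; lra).
    assert (r * x <= e - 1) by lra.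
    assert (r * x * (E - 1) <= 1 * ((E - 1) * (E - 1))) by nra.
    nra.
  - (* [e - 1 <= r x e] and [E - 1 >= x] *)
    assert (e - 1 <= r * x * e) by nra.
    assert (r * x <= r * (E - 1)) by nra.
    assert (r * x * e <= r * (E - 1) * E) by (apply Rmult_le_compat; nra).
    assert (r * ((E - 1) * (E - 1)) <= 1 * ((E - 1) * (E - 1)))
      by (apply Rmult_le_compat_r; nra).
    lra.
Qed.

(** * Positivity of the normalized gap *)

(* [(V0 - V1)(q) - (V0 - V1)(q e^T)], normalized by [v0 q]. *)
Definition gap (a b T : R) : R :=
  weight a b T * (1 - exp (b * T)) / b
  + (1 - weight a b T) * (1 - exp (a * T)) / a + exp T - 1.

(** Freeze the weight at its value for [T] and let only [s] run from [0] to [T]. The resulting [G]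
    vanishes at [0], and the bracket in [dG] is strictly concave and zero at both [0] and [T], hence
    positive in between; the mean value theorem concludes. *)
Lemma gap_pos (a b T : R) : a < 0 -> 1 < b -> 0 < T -> 0 < gap a b T.
Proof.
  intros Ha Hb HT.
  destruct (weight_bounds a b T Ha Hb HT) as [Hw0 Hw1].
  pose proof (weight_barycenter a b T Ha Hb HT) as Hbar.
  unfold gap; set (be := weight a b T) in *.
  set (G := fun s => be * (1 - exp (b * s)) / b + (1 - be) * (1 - exp (a * s)) / a + exp s - 1).
  set (dG := fun s => exp s * (1 - be * exp ((b - 1) * s) - (1 - be) * exp ((a - 1) * s))).
  assert (HG : forall s, is_derive G s (dG s)).
  { intros s; unfold G, dG; auto_derive; [repeat split; lra |].
    replace (exp ((b - 1) * s)) with (exp (b * s) / exp s)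
      by (unfold Rdiv; rewrite <- exp_Ropp, <- exp_plus; f_equal; ring).
    replace (exp ((a - 1) * s)) with (exp (a * s) / exp s)
      by (unfold Rdiv; rewrite <- exp_Ropp, <- exp_plus; f_equal; ring).
    pose proof (exp_pos s). field; lra. }
  destruct (MVT_cor2 G dG 0 T HT) as [c [Hc1 Hc2]].
  { intros c _; apply is_derive_Reals, HG. }
  assert (HG0 : G 0 = 0).
  { unfold G; rewrite !Rmult_0_r, exp_0; field; lra. }
  assert (Hpos : 0 < dG c).
  { unfold dG; apply Rmult_lt_0_compat; [apply exp_pos |].
    assert (Hth : 0 < c / T < 1).
    { split; [apply Rdiv_lt_0_compat; lra |].
      apply -> Rdiv_lt_1; lra. }
    pose proof (exp_chord_strict (b - 1) (c / T) T ltac:(lra) ltac:(lra) Hth) as H1.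
    pose proof (exp_chord_strict (a - 1) (c / T) T ltac:(lra) ltac:(lra) Hth) as H2.
    replace (c / T * T) with c in H1, H2 by (field; lra).
    set (th := c / T) in *.
    nra. }
  fold (G T); nra.
Qed.

(** A continuous positive function attains a positive minimum on a compact interval; [d > 0] keeps
    away from the singular formula at [0]. *)
Lemma gap_lower_bound (a b d M : R) :
  a < 0 -> 1 < b -> 0 < d ->
  exists mu, 0 < mu /\ forall T, d <= T <= M -> mu <= gap a b T.
Proof.
  intros Ha Hb Hd.
  destruct (Rle_lt_dec d M) as [HdM | HdM].
  2: { exists 1; split; [lra | intros T HT; lra]. }
  destruct (continuity_ab_min (gap a b) d M HdM) as [m [Hm1 Hm2]].
  { intros c Hc; apply continuity_pt_filterlim, (ex_derive_continuous (gap a b) c).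
    destruct (exp_lt1_gt1 a b c) as [H1 H2]; try lra.
    unfold gap, weight; auto_derive; repeat split; lra. }
  exists (gap a b m); split; [apply gap_pos; lra | exact Hm1].
Qed.

(** * Consequences of value matching and smooth pasting *)

(** Value matching takes the same shape at both thresholds: the weights are [be], [1 - be] at [q],
    and these times [e^((b-1)T)], [e^((a-1)T)] at [Q]. Each pair sums to [1], by smooth pasting. *)
Lemma thresholds_equations (a b v0 v1 D K q Q : R) :
  a < 0 -> 1 < b -> switching_thresholds a b v0 v1 D K q Q ->
  let T := ln (Q / q) in
  let be := weight a b T in
  0 < T /\ Q = q * exp T /\
  v0 * q * (1 - be / b - (1 - be) / a) = - v1 - K /\
  v0 * Q * (1 - be * exp ((b - 1) * T) / b - (1 - be) * exp ((a - 1) * T) / a) = - v1 + D.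
Proof.
  intros Ha Hb [[Hq HqQ] [Y [X [E1 [E2 [E3 E4]]]]]] T be.
  assert (HQ : 0 < Q) by lra.
  assert (D0 : forall x, 0 < x -> Derive (V0 b Y) x = Y * b * Rpower x b / x).
  { intros x Hx; apply is_derive_unique; unfold V0, Rpower.
    auto_derive; [lra | field; lra]. }
  assert (D1 : forall x, 0 < x ->
    Derive (V1 a v0 v1 X) x = X * a * Rpower x a / x + v0).
  { intros x Hx; apply is_derive_unique; unfold V1, Rpower.
    auto_derive; [lra | field; lra]. }
  rewrite D0, D1 in E3 by lra.
  rewrite D0, D1 in E4 by lra.
  assert (HT : 0 < T).
  { unfold T; rewrite <- ln_1; apply ln_increasing; [lra |].
    apply -> Rlt_div_r; lra. }
  assert (HQe : Q = q * exp T).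
  { unfold T; rewrite exp_ln; [field; lra | apply Rdiv_lt_0_compat; lra]. }
  (* The factor [exp T] is split off to cancel against [Q = q e^T] in the derivative condition at
     [Q]. *)
  assert (Hpow : forall g, Rpower Q g = Rpower q g * exp T * exp ((g - 1) * T)).
  { intros g; rewrite HQe, <- Rpower_mult_distr by (try apply exp_pos; lra).
    unfold Rpower at 2; rewrite ln_exp, Rmult_assoc, <- exp_plus; f_equal; f_equal; ring. }
  unfold V0, V1 in E1, E2.
  rewrite !Hpow in E1, E3.
  pose proof (exp_pos T) as HeT.
  (* The two equations of the linear system are smooth pasting at [q] and at [Q], each multiplied by
     [q]. *)
  destruct (weight_unique a b T (Y * b * Rpower q b) (- (X * a * Rpower q a)) (v0 * q))
    as [Hu Hw]; try assumption.
  - apply Rmult_eq_reg_r with (/ q); [| apply Rinv_neq_0_compat; lra].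
    transitivity (Y * b * Rpower q b / q - X * a * Rpower q a / q); [field; lra |].
    rewrite E4; field; lra.
  - apply Rmult_eq_reg_r with (/ q); [| apply Rinv_neq_0_compat; lra].
    rewrite HQe in E3.
    transitivity (Y * b * (Rpower q b * exp T * exp ((b - 1) * T)) / (q * exp T)
      - X * a * (Rpower q a * exp T * exp ((a - 1) * T)) / (q * exp T)); [field; lra |].
    rewrite E3; field; lra.
  - fold be in Hu, Hw.
    assert (HY : Y * Rpower q b = v0 * q * be / b) by (rewrite <- Hu; field; lra).
    assert (HX : X * Rpower q a = - (v0 * q * (1 - be)) / a) by (rewrite <- Hw; field; lra).
    repeat split; try assumption.
    + rewrite HY, HX in E2. unfold Rdiv in *. nra.
    + rewrite <- !Rmult_assoc, HY, HX, HQe in E1. rewrite HQe.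
      unfold Rdiv in *. nra.
Qed.

(** Subtracting the two value-matching identities eliminates [v1]. *)
Lemma thresholds_gap (a b v0 v1 D K q Q : R) :
  a < 0 -> 1 < b -> switching_thresholds a b v0 v1 D K q Q ->
  v0 * q * gap a b (ln (Q / q)) = K + D.
Proof.
  intros Ha Hb Hs.
  destruct (thresholds_equations a b v0 v1 D K q Q Ha Hb Hs) as [HT [HQ [E1 E2]]].
  set (T := ln (Q / q)) in *.
  unfold gap.
  replace (exp (b * T)) with (exp T * exp ((b - 1) * T))
    by (rewrite <- exp_plus; f_equal; ring).
  replace (exp (a * T)) with (exp T * exp ((a - 1) * T))
    by (rewrite <- exp_plus; f_equal; ring).
  replace (K + D) with ((- v1 + D) - (- v1 - K)) by ring.
  rewrite <- E1, <- E2, HQ. field; lra.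
Qed.

(** In [thresholds_gap] every factor other than [v0] is positive, and so is [K + D]. *)
Lemma thresholds_v0_pos (a b v0 v1 D K q Q : R) :
  a < 0 -> 1 < b -> 0 < D -> 0 < K ->
  switching_thresholds a b v0 v1 D K q Q -> 0 < v0.
Proof.
  intros Ha Hb HD HK Hs.
  pose proof (thresholds_gap a b v0 v1 D K q Q Ha Hb Hs) as H.
  destruct (thresholds_equations a b v0 v1 D K q Q Ha Hb Hs) as [HT _].
  destruct Hs as [Hq _].
  pose proof (gap_pos a b _ Ha Hb HT) as Hg.
  assert (0 < q * gap a b (ln (Q / q))) by (apply Rmult_lt_0_compat; lra).
  nra.
Qed.

(* [1 - x / b - y / a] with [x + y = 1] lies between its values at the vertices. *)
Lemma thresholds_bounds (a b v0 v1 D K q Q : R) :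
  a < 0 -> 1 < b -> 0 < D -> 0 < K ->
  switching_thresholds a b v0 v1 D K q Q ->
  - v1 - K <= v0 * q * (1 - / a) /\ v0 * Q * (1 - / b) <= - v1 + D /\ K < - v1.
Proof.
  intros Ha Hb HD HK Hs.
  pose proof (thresholds_v0_pos a b v0 v1 D K q Q Ha Hb HD HK Hs) as Hv.
  destruct (thresholds_equations a b v0 v1 D K q Q Ha Hb Hs) as [HT [_ [E1 E2]]].
  destruct Hs as [[Hq HqQ] _].
  pose proof (weight_bounds a b _ Ha Hb HT) as Hw.
  pose proof (weight_barycenter a b _ Ha Hb HT) as Hbar.
  set (T := ln (Q / q)) in *. set (be := weight a b T) in *.
  pose proof (exp_pos ((b - 1) * T)) as P1.
  pose proof (exp_pos ((a - 1) * T)) as P2.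
  assert (Hvq : 0 < v0 * q) by nra.
  assert (HvQ : 0 < v0 * Q) by nra.
  assert (Hia : / a < 0) by (apply Rinv_lt_0_compat; lra).
  assert (Hib : 0 < / b < 1).
  { split; [apply Rinv_0_lt_compat; lra | rewrite <- Rinv_1; apply Rinv_lt_contravar; lra]. }
  unfold Rdiv in *.
  repeat split.
  - rewrite <- E1; apply Rmult_le_compat_l; nra.
  - rewrite <- E2; apply Rmult_le_compat_l; [lra |].
    set (x := be * exp ((b - 1) * T)) in *.
    set (y := (1 - be) * exp ((a - 1) * T)) in *.
    assert (0 < y) by (unfold y; apply Rmult_lt_0_compat; lra).
    nra.
  - assert (0 < v0 * q * (1 - be * / b - (1 - be) * / a));
      [apply Rmult_lt_0_compat; nra | lra].
Qed.

(** * Limits as both costs vanish *)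

Lemma near_costs_0 (P : R -> R -> Prop) (d : R) :
  0 < d -> (forall D K, 0 < D < d -> 0 < K < d -> P D K) ->
  filter_prod (at_right 0) (at_right 0) (fun p => P (fst p) (snd p)).
Proof.
  intros Hd H.
  assert (Hr : at_right 0 (fun x => 0 < x < d)).
  { exists (mkposreal d Hd); intros x Hx Hx0.
    change (Rabs (x + - 0) < d) in Hx.
    apply Rabs_def2 in Hx; lra. }
  apply (Filter_prod _ _ _ (fun x => 0 < x < d) (fun x => 0 < x < d)); auto.
Qed.

Lemma lim_costs_comp (g : R -> R) (f : R -> R -> R) (l : R) :
  continuous g l -> lim_costs_to_0 f l -> lim_costs_to_0 (fun D K => g (f D K)) (g l).
Proof.
  intros Hg Hf; exact (filterlim_comp _ _ _ (fun p => f (fst p) (snd p)) g _ _ _ Hf Hg).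
Qed.

Lemma lim_costs_mult (f g : R -> R -> R) (l m : R) :
  lim_costs_to_0 f l -> lim_costs_to_0 g m ->
  lim_costs_to_0 (fun D K => f D K * g D K) (l * m).
Proof.
  intros Hf Hg.
  exact (filterlim_comp_2 _ _ _ Hf Hg (filterlim_mult (K := R_AbsRing) l m)).
Qed.

Lemma lim_costs_eps (f : R -> R -> R) (l : R) :
  (forall e, 0 < e -> exists d, 0 < d /\
     forall D K, 0 < D < d -> 0 < K < d -> Rabs (f D K - l) < e) ->
  lim_costs_to_0 f l.
Proof.
  intros H; apply filterlim_locally; intros [e He].
  destruct (H e He) as [d [Hd Hf]].
  exact (near_costs_0 (fun D K => Rabs (f D K - l) < e) d Hd Hf).
Qed.

Lemma lim_costs_ext (f g : R -> R -> R) (l d : R) :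
  0 < d -> (forall D K, 0 < D < d -> 0 < K < d -> f D K = g D K) ->
  lim_costs_to_0 f l -> lim_costs_to_0 g l.
Proof.
  intros Hd H; apply filterlim_ext_loc.
  exact (near_costs_0 (fun D K => f D K = g D K) d Hd H).
Qed.

(** * Convergence of the thresholds *)

Lemma log_ratio_lim (a b v0 v1 eps : R) (Qlow Qup : R -> R -> R) :
  a < 0 -> 1 < b -> 0 < eps ->
  (forall D K, 0 < D < eps -> 0 < K < eps ->
     switching_thresholds a b v0 v1 D K (Qlow D K) (Qup D K)) ->
  lim_costs_to_0 (fun D K => ln (Qup D K / Qlow D K)) 0.
Proof.
  intros Ha Hb Heps Hs; apply lim_costs_eps; intros e He.
  (* The signs of [v0] and [v1] do not depend on the costs, so one sample pair [D = K = eps / 2]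
     determines them. *)
  assert (Hh : 0 < eps / 2 < eps) by lra.
  pose proof (thresholds_v0_pos _ _ _ _ _ _ _ _ Ha Hb (proj1 Hh) (proj1 Hh) (Hs _ _ Hh Hh)) as Hv.
  destruct (thresholds_bounds _ _ _ _ _ _ _ _ Ha Hb (proj1 Hh) (proj1 Hh) (Hs _ _ Hh Hh))
    as [_ [_ Hv1]].
  assert (Hv1' : v1 < 0) by lra.
  assert (Hia : / a < 0) by (apply Rinv_lt_0_compat; lra).
  assert (Hib : 0 < / b < 1).
  { split; [apply Rinv_0_lt_compat; lra | rewrite <- Rinv_1; apply Rinv_lt_contravar; lra]. }
  (* From [thresholds_bounds]: [Qlow >= c1] once [K < - v1 / 2], and [Qup <= c2] once
     [D < - v1 / 2]. Thus [T <= ln (c2 / c1)]. *)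
  set (c1 := - v1 / 2 / (v0 * (1 - / a))).
  set (c2 := - v1 * 2 / (v0 * (1 - / b))).
  assert (P1 : 0 < v0 * (1 - / a)) by (apply Rmult_lt_0_compat; lra).
  assert (P2 : 0 < v0 * (1 - / b)) by (apply Rmult_lt_0_compat; lra).
  assert (Hc1 : 0 < c1) by (unfold c1; apply Rdiv_lt_0_compat; lra).
  assert (Hc2 : 0 < c2) by (unfold c2; apply Rdiv_lt_0_compat; lra).
  destruct (gap_lower_bound a b e (ln (c2 / c1)) Ha Hb He) as [mu [Hmu Hgap]].
  assert (Hm : 0 < v0 * c1 * mu) by (apply Rmult_lt_0_compat; [apply Rmult_lt_0_compat |]; assumption).
  (* The three bounds ensure, in turn, that the thresholds exist, that [c1] and [c2] apply, and that
     [K + D < v0 * c1 * mu]. *)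
  exists (Rmin eps (Rmin (- v1 / 2) (v0 * c1 * mu / 2))); split.
  { repeat apply Rmin_glb_lt; lra. }
  intros D K [HD HDd] [HK HKd].
  assert (Hmin : forall x, x < Rmin eps (Rmin (- v1 / 2) (v0 * c1 * mu / 2)) ->
    x < eps /\ x < - v1 / 2 /\ x < v0 * c1 * mu / 2).
  { intros x Hx; apply Rmin_Rgt_l in Hx; destruct Hx as [Hx1 Hx].
    apply Rmin_Rgt_l in Hx; lra. }
  apply Hmin in HDd; apply Hmin in HKd; clear Hmin.
  assert (HsDK := Hs D K ltac:(lra) ltac:(lra)).
  destruct (thresholds_bounds _ _ _ _ _ _ _ _ Ha Hb HD HK HsDK) as [B1 [B2 _]].
  pose proof (thresholds_gap _ _ _ _ _ _ _ _ Ha Hb HsDK) as G.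
  destruct (thresholds_equations _ _ _ _ _ _ _ _ Ha Hb HsDK) as [HT _].
  destruct HsDK as [[Hq HqQ] _].
  set (q := Qlow D K) in *. set (Q := Qup D K) in *.
  assert (Hq1 : c1 <= q).
  { unfold c1; apply <- Rle_div_l; lra. }
  assert (HQ2 : Q <= c2).
  { unfold c2; apply -> Rle_div_r; lra. }
  rewrite Rminus_0_r, Rabs_pos_eq by lra.
  (* If [T >= e], then [gap >= mu] forces [K + D >= v0 * c1 * mu], a contradiction. *)
  apply Rnot_le_lt; intros HeT.
  assert (Hmug : mu <= gap a b (ln (Q / q))).
  { apply Hgap; split; [exact HeT |].
    apply ln_le; [apply Rdiv_lt_0_compat; lra |].
    unfold Rdiv; apply Rmult_le_compat; try lra.
    - left; apply Rinv_0_lt_compat; lra.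
    - apply Rinv_le_contravar; lra. }
  assert (v0 * c1 * mu <= v0 * q * gap a b (ln (Q / q))).
  { apply Rmult_le_compat; nra. }
  lra.
Qed.

(** A squeeze by [weight_near_0], valid because [T] is positive for small positive costs. *)
Lemma weight_lim (a b : R) (T : R -> R -> R) (eps : R) :
  a < 0 -> 1 < b -> 0 < eps ->
  (forall D K, 0 < D < eps -> 0 < K < eps -> 0 < T D K) ->
  lim_costs_to_0 T 0 ->
  lim_costs_to_0 (fun D K => weight a b (T D K)) ((1 - a) / (b - a)).
Proof.
  intros Ha Hb Heps Hpos HT.
  assert (HE : continuous (fun t => exp ((b - a) * t) - 1) 0).
  { apply (ex_derive_continuous (fun t => exp ((b - a) * t) - 1)); auto_derive; trivial. }
  apply (lim_costs_comp _ T 0) in HE; [| exact HT].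
  cbv beta in HE; rewrite Rmult_0_r, exp_0, Rminus_diag in HE.
  apply filterlim_locally; intros e.
  pose proof (proj1 (filterlim_locally _ _) HE e) as HE'.
  pose proof (near_costs_0 (fun D K => 0 < T D K) eps Heps Hpos) as HP.
  generalize (filter_and _ _ HE' HP); apply filter_imp; intros [D K] [H1 H2].
  simpl in H1, H2 |- *.
  change (Rabs (exp ((b - a) * T D K) - 1 - 0) < e) in H1.
  change (Rabs (weight a b (T D K) - (1 - a) / (b - a)) < e).
  apply Rabs_def2 in H1.
  pose proof (weight_near_0 a b (T D K) Ha Hb H2); lra.
Qed.

Lemma thresholds_lim (a b v0 v1 eps : R) (Qlow Qup : R -> R -> R) :
  a < 0 -> 1 < b -> 0 < v0 -> 0 < eps ->
  (forall D K, 0 < D < eps -> 0 < K < eps ->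
     switching_thresholds a b v0 v1 D K (Qlow D K) (Qup D K)) ->
  let l := a * b * v1 / ((1 - a) * (b - 1) * v0) in
  lim_costs_to_0 Qup l /\ lim_costs_to_0 Qlow l.
Proof.
  intros Ha Hb Hv Heps Hs l.
  pose proof (log_ratio_lim a b v0 v1 eps Qlow Qup Ha Hb Heps Hs) as HT.
  set (T := fun D K => ln (Qup D K / Qlow D K)) in *.
  assert (Heq : forall D K, 0 < D < eps -> 0 < K < eps ->
    0 < T D K /\ Qup D K = Qlow D K * exp (T D K) /\
    v0 * Qlow D K * (1 - weight a b (T D K) / b - (1 - weight a b (T D K)) / a) = - v1 - K).
  { intros D K HD HK.
    destruct (thresholds_equations a b v0 v1 D K _ _ Ha Hb (Hs D K HD HK))
      as [H1 [H2 [H3 _]]]; auto. }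
  assert (Hw : lim_costs_to_0 (fun D K => weight a b (T D K)) ((1 - a) / (b - a))).
  { apply weight_lim with eps; try assumption; intros D K HD HK; apply Heq; assumption. }
  assert (HK : lim_costs_to_0 (fun _ K => K) 0).
  { apply lim_costs_eps; intros e He; exists e; split; [exact He |].
    intros D K _ HK; rewrite Rminus_0_r, Rabs_pos_eq; lra. }
  (* Value matching at the lower threshold reads [Qlow = (- v1 - K) * g (weight a b T)]. *)
  set (g := fun x => / (v0 * (1 - x / b - (1 - x) / a))).
  assert (Hg0 : forall x, 0 < x < 1 -> 0 < 1 - x / b - (1 - x) / a).
  { intros x Hx.
    assert (Hia : / a < 0) by (apply Rinv_lt_0_compat; lra).
    assert (Hib : 0 < / b < 1).
    { split; [apply Rinv_0_lt_compat; lra | rewrite <- Rinv_1; apply Rinv_lt_contravar; lra]. }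
    unfold Rdiv; nra. }
  assert (Hr : 0 < (1 - a) / (b - a) < 1).
  { split; [apply Rdiv_lt_0_compat; lra |].
    apply -> Rdiv_lt_1; lra. }
  assert (Hcg : continuous g ((1 - a) / (b - a))).
  { apply (ex_derive_continuous g); unfold g; auto_derive.
    pose proof (Hg0 _ Hr) as H; unfold Rdiv, Rminus in H |- *.
    repeat split; try lra; apply Rgt_not_eq, Rmult_lt_0_compat; lra. }
  assert (Hlow : lim_costs_to_0 Qlow l).
  { apply lim_costs_ext with (f := fun D K => (- v1 - K) * g (weight a b (T D K))) (d := eps);
      [exact Heps | |].
    - intros D K HD HK'; destruct (Heq D K HD HK') as [H1 [_ H3]].
      pose proof (Hg0 _ (weight_bounds a b _ Ha Hb H1)) as H.
      rewrite <- H3; unfold g; field.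
      repeat split; try lra.
      (* [E] is the vanishing of the coefficient with denominators cleared; multiplying by [a * b]
         brings it to the form contradicting [H]. *)
      intros E; apply Rlt_not_eq in H; apply H; symmetry.
      apply Rmult_eq_reg_r with (a * b); [| nra].
      field_simplify; [| lra]; nra.
    - replace l with ((- v1 - 0) * g ((1 - a) / (b - a))).
      + apply lim_costs_mult.
        * apply (lim_costs_comp (fun x => - v1 - x)); [| exact HK].
          apply (ex_derive_continuous (fun x => - v1 - x)); auto_derive; trivial.
        * apply lim_costs_comp; assumption.
      + unfold g, l.
        replace (1 - (1 - a) / (b - a) / b - (1 - (1 - a) / (b - a)) / a)
          with (- ((1 - a) * (b - 1)) / (a * b)) by (field; lra).
        field; lra. }
  split; [| exact Hlow].
  apply lim_costs_ext with (f := fun D K => Qlow D K * exp (T D K)) (d := eps);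
    [exact Heps | |].
  - intros D K HD HK'; symmetry; apply (Heq D K HD HK').
  - replace l with (l * exp 0) by (rewrite exp_0; ring).
    apply lim_costs_mult; [exact Hlow |].
    apply lim_costs_comp; [| exact HT].
    apply (ex_derive_continuous exp); auto_derive; trivial.
Qed.

Theorem proposition2 (eta sigma k d0Q d0C d1Q d1C : R)
  (Qlow Qup : R -> R -> R)
  (hsigma : 0 < sigma) (hk : 0 < k) (hketa : eta < k) :
  let g0 := gamma0 eta sigma k in
  let g1 := gamma1 eta sigma k in
  let v0 := (d1Q - d0Q) / (k - eta) in
  let v1 := (d1C - d0C) / k in
  let den := ((1 - g0) * g1 * (g1 - 1) - (1 - g1) * g0 * (g0 - 1)) * v0 in
  let Qstar := (g1 - g0) * g0 * g1 * v1 / den in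
  (exists eps : R, 0 < eps /\
     forall D K : R, 0 < D < eps -> 0 < K < eps ->
       switching_thresholds g0 g1 v0 v1 D K (Qlow D K) (Qup D K)) ->
  1 < g1 /\ g0 < 0 /\
  den <> 0 /\
  Qstar = g0 * g1 * v1 / ((1 - g0) * (g1 - 1) * v0) /\
  lim_costs_to_0 Qup Qstar /\
  lim_costs_to_0 Qlow Qstar.
Proof.
  intros g0 g1 v0 v1 den Qstar [eps [Heps Hs]].
  assert (Hb : 1 < g1) by (apply gamma1_gt1; assumption).
  assert (Ha : g0 < 0) by (apply gamma0_lt0; assumption).
  assert (Hh : 0 < eps / 2 < eps) by lra.
  pose proof (thresholds_v0_pos _ _ _ _ _ _ _ _ Ha Hb (proj1 Hh) (proj1 Hh) (Hs _ _ Hh Hh)) as Hv.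
  (* The factor [g1 - g0] also occurs in the numerator of [Qstar], so cancelling it yields the
     second form. *)
  assert (Hden : den = (g1 - g0) * ((1 - g0) * (g1 - 1) * v0)) by (unfold den; ring).
  assert (Hp : 0 < (1 - g0) * (g1 - 1) * v0) 
    by (apply Rmult_lt_0_compat; [apply Rmult_lt_0_compat |]; lra).
  assert (HQ : Qstar = g0 * g1 * v1 / ((1 - g0) * (g1 - 1) * v0)).
  { unfold Qstar; rewrite Hden; field; repeat split; lra. }
  repeat split; try assumption.
  - rewrite Hden; apply Rgt_not_eq, Rmult_lt_0_compat; lra.
  - rewrite HQ; apply (thresholds_lim _ _ _ _ eps Qlow Qup Ha Hb Hv Heps Hs).
  - rewrite HQ; apply (thresholds_lim _ _ _ _ eps Qlow Qup Ha Hb Hv Heps Hs).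
Qed.
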